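(* $F_e(4,4;17) \leq 25$.
   Context: All graphs are finite, undirected, without loops or multiple edges. $V(G)$ and $E(G)$ denote the vertex set and edge set of $G$. A $p$-clique of $G$ is a set of $p$ pairwise adjacent vertices; $\mathrm{cl}(G)$ is the largest positive integer $p$ such that $G$ contains a $p$-clique. For positive integers $a_1,\ldots,a_r$, the symbol $G \stackrel{e}{\to} (a_1,\ldots,a_r)$ means that in every $r$-coloring of $E(G)$ (an arbitrary assignment of one of $r$ colors to each edge) there is, for some $i\in\{1,\ldots,r\}$, an $a_i$-clique all of whose edges have the $i$-th color. The edge Folkman number is $F_e(a_1,\ldots,a_r;q) = \min\{|V(G)| : G \stackrel{e}{\to} (a_1,\ldots,a_r) \text{ and } \mathrm{cl}(G) < q\}$. *)

(* Defs.v *)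
From mathcomp Require Import all_boot.

Set Implicit Arguments.
Unset Strict Implicit.
Unset Printing Implicit Defensive.

Record sgraph := SGraph {
  vertex :> finType;
  adj : rel vertex;
  adj_sym : symmetric adj;
  adj_irrefl : irreflexive adj
}.

(* Edges are unordered: the two-element sets of adjacent vertices. *)
Definition edges (G : sgraph) : {set {set G}} :=
  [set [set x; y] | x in G, y in G & adj x y].

Definition edge (G : sgraph) := {e : {set G} | e \in edges G}.

Definition clique (G : sgraph) (K : {set G}) : bool :=
  [forall x in K, forall y in K, (x != y) ==> adj x y].

Definition pclique (G : sgraph) (p : nat) (K : {set G}) : bool :=
  clique K && (#|K| == p).

Definition cl (G : sgraph) : nat := \max_(K : {set G} | clique K) #|K|.

Definition monochromatic (G : sgraph) (r : nat) (c : edge G -> 'I_r)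
    (i : 'I_r) (K : {set G}) : Prop :=
  forall e : edge G, val e \subset K -> c e = i.

Definition edge_arrows (G : sgraph) (r : nat) (a : r.-tuple nat) : Prop :=
  forall c : edge G -> 'I_r,
  exists (i : 'I_r) (K : {set G}), pclique (tnth a i) K /\ monochromatic c i K.

Definition edge_folkman_graph (r : nat) (a : r.-tuple nat) (q : nat)
    (G : sgraph) : Prop :=
  edge_arrows G a /\ cl G < q.

(* The minimum is a relation rather than a function, so that no default value
   is needed when there is no graph to minimize over. *)
Definition is_edge_folkman_number (r : nat) (a : r.-tuple nat) (q n : nat)
    : Prop :=
  (exists G : sgraph, edge_folkman_graph a q G /\ #|G| = n) /\
  (forall G : sgraph, edge_folkman_graph a q G -> n <= #|G|).

(* Main.v *)
Require Import Defs.
From mathcomp Require Import all_boot zify.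
From Stdlib Require Import Classical_Prop Wf_nat.

Set Implicit Arguments.
Unset Strict Implicit.
Unset Printing Implicit Defensive.

(** The witness is the join G of the complete graph K on 12 vertices with the
    graph H on the residues modulo 13 in which two residues are adjacent when
    their difference is neither 0 nor a cube.  It has 25 vertices, and since H
    has no 5-clique ([noncube_clique5]), no clique of G has more than 16.

    That G arrows (4,4) rests on three facts: R(3,4) <= 9 ([ramsey_3_4]); H
    has no three independent vertices ([noncube_independent3]); and every
    vertex partition of H leaves a triangle in the first part or a 4-clique
    in the second ([noncube_split]).

    Suppose that a red-blue coloring of the edges of G has no monochromatic
    4-clique, and let v be a vertex of K.  The red neighborhood of v contains
    no 9-clique of G: by R(3,4) <= 9 that clique would hold a blue 4-clique,
    or a red triangle and, with v, a red 4-clique.  The same is true of blue.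
    Among the other 11 vertices of K, let v have at least 6 neighbors in one
    color, say red.
    - With 7 or more, the red neighbors of v in H are independent, so there
      are at most two of them.
    - With exactly 6, and so 5 blue ones, the partition fact for H produces a
      9-clique: 6 + 3 vertices in the red neighborhood of v or 5 + 4 in the
      blue one.
    So each vertex of K has at most two neighbors in H in some color
    ([one_color_scarce]).

    Suppose that four vertices of K have at most two red neighbors in H each.
    They do not form a red 4-clique, so two of them span a blue edge, and at
    least 13 - 4 = 9 vertices of H are blue neighbors of both.  Nine vertices
    of H contain a 4-clique of H, by R(3,4) <= 9 again, as no three vertices
    of H are independent.  That 4-clique has a blue edge, which the first blue
    edge completes to a blue 4-clique.  So each color is scarce at no more than
    three vertices of K ([red_not_scarce]), and 3 + 3 < 12. *)

(** * Cliques of a relation inside a set *)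

Definition rclique (T : finType) (r : rel T) (K : {set T}) : bool :=
  [forall x in K, forall y in K, (x != y) ==> r x y].

Definition has_clique (T : finType) (r : rel T) (k : nat) (S : {set T}) : bool :=
  [exists K : {set T}, [&& K \subset S, #|K| == k & rclique r K]].

Definition nbr (T : finType) (r : rel T) (S : {set T}) (v : T) : {set T} :=
  [set y in S | (y != v) && r v y].

Lemma rcliqueP (T : finType) (r : rel T) (K : {set T}) :
  reflect {in K &, forall x y, x != y -> r x y} (rclique r K).
Proof.
apply: (iffP forall_inP) => [rK x y xK yK|rK x xK].
  by move/forall_inP: (rK x xK) => /(_ y yK) /implyP.
by apply/forall_inP => y yK; apply/implyP; apply: rK.
Qed.

Lemma has_cliqueP (T : finType) (r : rel T) (k : nat) (S : {set T}) :
  reflect (exists K : {set T}, [/\ K \subset S, #|K| = k & rclique r K])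
          (has_clique r k S).
Proof.
apply: (iffP existsP) => -[K].
  by case/and3P=> KS /eqP cK rK; exists K.
by case=> KS cK rK; exists K; rewrite KS cK eqxx.
Qed.

Lemma rclique_sub (T : finType) (r : rel T) (A B : {set T}) :
  A \subset B -> rclique r B -> rclique r A.
Proof.
move=> /subsetP AB /rcliqueP rB; apply/rcliqueP => x y xA yA.
by apply: rB; apply: AB.
Qed.

Lemma has_clique_sub (T : finType) (r : rel T) (k : nat) (A B : {set T}) :
  A \subset B -> has_clique r k A -> has_clique r k B.
Proof.
move=> AB /has_cliqueP [K [KA cK rK]]; apply/has_cliqueP; exists K; split=> //.
exact: subset_trans KA AB.
Qed.

Lemma rclique_setU1 (T : finType) (r : rel T) (v : T) (K : {set T}) :
  symmetric r -> {in K, forall y, y != v -> r v y} -> rclique r K ->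
  rclique r (v |: K).
Proof.
move=> r_sym vK /rcliqueP rK; apply/rcliqueP => x y.
rewrite !in_setU1 => /predU1P [->|xK] /predU1P [->|yK]; rewrite ?eqxx // => xy.
- by apply: vK; rewrite // eq_sym.
- by rewrite r_sym; apply: vK.
- exact: rK.
Qed.

Lemma nbr_sub (T : finType) (r : rel T) (S : {set T}) (v : T) : nbr r S v \subset S.
Proof. by apply/subsetP => y; rewrite inE => /andP []. Qed.

Lemma has_clique_nbr (T : finType) (r : rel T) (k : nat) (S : {set T}) (v : T) :
  symmetric r -> v \in S -> has_clique r k (nbr r S v) -> has_clique r k.+1 S.
Proof.
move=> r_sym vS /has_cliqueP [K [/subsetP KN cK rK]].
apply/has_cliqueP; exists (v |: K); split.
- apply/subsetP => x /setU1P [-> //|/KN]; by rewrite inE => /andP [].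
- rewrite cardsU1 cK; case: (boolP (v \in K)) => // /KN.
  by rewrite inE eqxx andbF.
- apply: rclique_setU1 => // y /KN; by rewrite inE => /and3P [].
Qed.

Lemma rclique_has_clique (T : finType) (r : rel T) (k : nat) (S : {set T}) :
  rclique r S -> k <= #|S| -> has_clique r k S.
Proof.
move=> rS kS.
have : 0 < #|[set A : {set T} | A \subset S & #|A| == k]|.
  by rewrite cards_draws bin_gt0.
case/card_gt0P => K; rewrite inE => /andP [KS /eqP cK].
by apply/has_cliqueP; exists K; split=> //; apply: rclique_sub rS.
Qed.

Lemma has_clique1 (T : finType) (r : rel T) (S : {set T}) :
  0 < #|S| -> has_clique r 1 S.
Proof.
case/card_gt0P => x xS; apply/has_cliqueP; exists [set x].
rewrite sub1set cards1; split=> //; apply/rcliqueP => y z /set1P -> /set1P ->.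
by rewrite eqxx.
Qed.

Lemma has_clique2 (T : finType) (r : rel T) (S : {set T}) :
  has_clique r 2 S -> exists x y, [/\ x \in S, y \in S, x != y & r x y].
Proof.
case/has_cliqueP => K [/subsetP KS /eqP /cards2P [x [y [xy defK]]] /rcliqueP rK].
have [xK yK] : x \in K /\ y \in K by rewrite defK !inE !eqxx orbT.
by exists x, y; split; [exact: KS | exact: KS | | exact: rK].
Qed.

(** * Ramsey bounds for a pair of relations *)


(** A coloring with two colors is a pair of relations that may overlap, so that
    the roles of the colors can be exchanged by swapping arguments. *)
Definition covered (T : finType) (red blue : rel T) (S : {set T}) : bool :=
  rclique (relU red blue) S.

Lemma coveredC (T : finType) (red blue : rel T) (S : {set T}) :
  covered red blue S -> covered blue red S.
Proof.
move/rcliqueP => cS; apply/rcliqueP => x y xS yS xy /=.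
by rewrite orbC; apply: cS.
Qed.

Lemma covered_nbr (T : finType) (red blue r : rel T) (S : {set T}) (v : T) :
  covered red blue S -> covered red blue (nbr r S v).
Proof. exact/rclique_sub/nbr_sub. Qed.

Lemma card_nbr_covered (T : finType) (red blue : rel T) (S : {set T}) (v : T) :
  covered red blue S -> v \in S ->
  #|S| <= (#|nbr red S v| + #|nbr blue S v|).+1.
Proof.
move=> /rcliqueP cS vS; rewrite (cardsD1 v) vS add1n ltnS.
apply: leq_trans (leq_card_setU _ _); apply: subset_leq_card.
apply/subsetP => y; rewrite !inE => /andP [yv yS]; rewrite yv yS /=.
by apply: cS => //; rewrite eq_sym.
Qed.

Lemma ramsey_2 (T : finType) (red blue : rel T) (k : nat) (S : {set T}) :
  symmetric red -> covered red blue S -> k <= #|S| ->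
  has_clique red 2 S || has_clique blue k S.
Proof.
move=> red_sym /rcliqueP cS kS; apply/orP.
case: (boolP (rclique blue S)) => [bS|].
  by right; apply: rclique_has_clique.
rewrite negb_forall_in => /exists_inP [x xS].
rewrite negb_forall_in => /exists_inP [y yS].
rewrite negb_imply => /andP [xy /negbTE nb]; left.
have := cS x y xS yS xy; rewrite /= nb orbF => rxy.
apply: (has_clique_nbr (v := x)) => //; apply: has_clique1.
by apply/card_gt0P; exists y; rewrite inE yS eq_sym xy.
Qed.

Lemma ramsey_3_3 (T : finType) (red blue : rel T) (S : {set T}) :
  symmetric red -> symmetric blue -> covered red blue S -> 6 <= #|S| ->
  has_clique red 3 S || has_clique blue 3 S.
Proof.
move=> red_sym blue_sym cS S6.
have [v vS] : exists v, v \in S by apply/card_gt0P; apply: leq_trans S6.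
have := card_nbr_covered cS vS.
case: (leqP 3 #|nbr red S v|) => [red3 _|red3 degs].
  have /orP [red2|blue3] := ramsey_2 red_sym (covered_nbr red v cS) red3.
    by rewrite (has_clique_nbr red_sym vS red2).
  by rewrite orbC (has_clique_sub (nbr_sub _ _ _) blue3).
have blue3 : 3 <= #|nbr blue S v| by lia.
have /orP [blue2|red3'] := ramsey_2 blue_sym (coveredC (covered_nbr blue v cS)) blue3.
  by rewrite orbC (has_clique_nbr blue_sym vS blue2).
by rewrite (has_clique_sub (nbr_sub _ _ _) red3').
Qed.

(** Handshake: a pair counted from its lower end is counted once more from its
    upper end.  The order is that of the ranks in the enumeration of [T]. *)
Lemma sum_degrees_even (T : finType) (r : rel T) (S : {set T}) :
  symmetric r -> ~~ odd (\sum_(x in S) #|nbr r S x|).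
Proof.
move=> r_sym; pose before (x y : T) := enum_rank x < enum_rank y.
have deg x : x \in S -> #|nbr r S x| =
    \sum_(y in S) (before x y && r x y) + \sum_(y in S) (before y x && r y x).
  move=> xS; rewrite -big_split /= -sum1_card big_mkcond [RHS]big_mkcond /=.
  apply: eq_bigr => y _; rewrite inE /before (r_sym y x).
  case: (y \in S) => //=; rewrite -(inj_eq enum_rank_inj) -val_eqE /=.
  by case: ltngtP; case: (r x y).
rewrite (eq_bigr _ deg) big_split /=.
by rewrite [X in _ + X]exchange_big /= addnn odd_double.
Qed.

(** The recursion on degrees gives only 10.  With 9 vertices and no clique as
    required, red degrees are at most 3 and blue degrees at most 5, which forces
    all nine red degrees to be exactly 3; their sum 27 is odd. *)
Lemma ramsey_3_4 (T : finType) (red blue : rel T) (S : {set T}) :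
  symmetric red -> symmetric blue -> covered red blue S -> 9 <= #|S| ->
  has_clique red 3 S || has_clique blue 4 S.
Proof.
move=> red_sym blue_sym cS.
(* Regularity of degree 3 is forced only when there are exactly 9 vertices. *)
wlog S9 : S cS / #|S| = 9.
  move=> IH S9; have : 0 < #|[set A : {set T} | A \subset S & #|A| == 9]|.
    by rewrite cards_draws bin_gt0.
  case/card_gt0P => A; rewrite inE => /andP [AS /eqP cA].
  have cA9 : 9 <= #|A| by rewrite cA.
  have /orP [h|h] := IH A (rclique_sub AS cS) cA cA9.
    by rewrite (has_clique_sub AS h).
  by rewrite orbC (has_clique_sub AS h).
move=> _; apply/norP => -[red3 blue4].
have red_deg v : v \in S -> #|nbr red S v| <= 3.
  move=> vS; rewrite leqNgt; apply: contra red3 => red_deg4.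
  have /orP [red2|b4] := ramsey_2 red_sym (covered_nbr red v cS) red_deg4.
    exact: has_clique_nbr red2.
  by rewrite (has_clique_sub (nbr_sub _ _ _) b4) in blue4.
have blue_deg v : v \in S -> #|nbr blue S v| <= 5.
  move=> vS; rewrite leqNgt; apply: contra blue4 => blue_deg6.
  have /orP [r3|b3] := ramsey_3_3 red_sym blue_sym (covered_nbr blue v cS) blue_deg6.
    by rewrite (has_clique_sub (nbr_sub _ _ _) r3) in red3.
  exact: has_clique_nbr b3.
have red_deg3 v : v \in S -> #|nbr red S v| = 3.
  move=> vS; have := card_nbr_covered cS vS; rewrite S9.
  by have := red_deg v vS; have := blue_deg v vS; lia.
have := sum_degrees_even S red_sym.
by rewrite (eq_bigr _ red_deg3) sum_nat_const S9.
Qed.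

(** * Deciding the existence of cliques by search *)

(** Each clique is found from its first element in [s], so only the later
    neighbors of that element remain as candidates. *)
Fixpoint search_clique (T : eqType) (r : rel T) (k : nat) : seq T -> bool :=
  if k is k'.+1 then
    fix go s := if s is x :: s' then
                  search_clique r k' (filter (r x) s') || go s'
                else false
  else xpredT.

Lemma search_clique_sound (T : finType) (r : rel T) (k : nat) (s : seq T) :
  symmetric r -> uniq s -> search_clique r k s -> has_clique r k [set x in s].
Proof.
move=> r_sym; elim: k s => [|k IHk] s.
  move=> _ _; apply/has_cliqueP; exists set0; rewrite sub0set cards0; split=> //.
  by apply/rcliqueP => x y; rewrite inE.
elim: s => //= x s IHs /andP [xs us] /orP [|/(IHs us)]; last first.
  by apply: has_clique_sub; apply/subsetP => y; rewrite !inE orbC => ->.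
move/(IHk _ (filter_uniq _ us)) => kN; apply: (has_clique_nbr (v := x)) => //.
  by rewrite !inE eqxx.
apply: has_clique_sub kN; apply/subsetP => y; rewrite !inE mem_filter.
case/andP => rxy ys; rewrite ys orbT rxy andbT /=.
by apply: contraNneq xs => <-.
Qed.

Lemma search_clique_complete (T : finType) (r : rel T) (k : nat) (s : seq T) :
  has_clique r k [set x in s] -> search_clique r k s.
Proof.
elim: k s => [|k IHk] // s; elim: s => [|x s IHs].
  case/has_cliqueP => K [/subset_leq_card + cK _]; rewrite cK.
  by rewrite leqNgt (@eq_card0 _ [set y in [::]]) // => y; rewrite inE.
case/has_cliqueP => K [/subsetP Ks cK rK] /=; apply/orP.
case: (boolP (x \in K)) => xK; [left; apply: IHk | right; apply: IHs].
  apply/has_cliqueP; exists (K :\ x); split.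
  - apply/subsetP => y /setD1P [yx yK]; rewrite inE mem_filter.
    rewrite (rcliqueP _ _ rK) // 1?eq_sym //=.
    by have := Ks y yK; rewrite !inE (negbTE yx).
  - by apply/eqP; rewrite -eqSS -cK (cardsD1 x K) xK.
  - exact: rclique_sub (subD1set _ _) rK.
apply/has_cliqueP; exists K; split=> //; apply/subsetP => y yK.
by have := Ks y yK; rewrite !inE => /predU1P [yx|//]; rewrite -yx yK in xK.
Qed.

(** The elements of [rest] are put one after the other into [A] or into [B]; the
    test succeeds when every sequence of choices completes, at some point, a
    clique of size [s.+1] in [A] or of size [t.+1] in [B].  A new clique has to
    contain the element just placed, so only its neighbors are searched. *)
Fixpoint search_split (T : eqType) (r : rel T) (s t : nat) (rest A B : seq T) : bool :=
  if rest is x :: rest' then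
    (search_clique r s (filter (r x) A) || search_split r s t rest' (x :: A) B)
    && (search_clique r t (filter (r x) B) || search_split r s t rest' A (x :: B))
  else false.

Lemma search_split_sound (T : finType) (r : rel T) (s t : nat)
    (rest A B : seq T) (V : {set T}) :
  symmetric r -> uniq (rest ++ A ++ B) ->
  {subset A <= V} -> {subset B <= ~: V} ->
  search_split r s t rest A B ->
  has_clique r s.+1 V || has_clique r t.+1 (~: V).
Proof.
move=> r_sym.
have found k x X (W : {set T}) : x \notin X -> uniq X -> x \in W ->
    {subset X <= W} -> search_clique r k (filter (r x) X) -> has_clique r k.+1 W.
  move=> xX uX xW XW /(search_clique_sound r_sym (filter_uniq _ uX)) kN.
  apply: (has_clique_nbr (v := x)) => //.
  apply: has_clique_sub kN; apply/subsetP => y; rewrite !inE mem_filter.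
  case/andP => -> yX; rewrite XW // andbT.
  by apply: contraNneq xX => <-.
elim: rest A B => // x rest IH A B u AV BV /= /andP [sA sB].
have uxA : uniq (rest ++ (x :: A) ++ B).
  by rewrite (perm_uniq (permEl (perm_catCA rest [:: x] (A ++ B)))).
have uxB : uniq (rest ++ A ++ x :: B).
  rewrite catA (perm_uniq (permEl (perm_catCA (rest ++ A) [:: x] B))).
  by rewrite -catA.
move: (uxA) (uxB); rewrite !cat_uniq /=.
move=> /and3P [_ _ /and3P [/andP [xA uA] _ _]].
move=> /and3P [_ _ /and3P [_ _ /andP [xB uB]]].
case: (boolP (x \in V)) => xV.
  case/orP: sA => [/(found _ _ _ V xA uA xV AV) -> //|]; apply: IH => // y.
  by case/predU1P => [->|/AV].
have xVC : x \in ~: V by rewrite inE.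
case/orP: sB => [/(found _ _ _ _ xB uB xVC BV) ->|]; first by rewrite orbT.
apply: IH => // y.
by case/predU1P => [->|/BV].
Qed.

(** * The graph of non-cubic differences modulo 13 *)

(** The nonzero cubes modulo 13 are 1, 5, 8 and 12.  They are closed under
    negation, so that the absolute difference, written here with truncated
    subtractions, can stand for the difference modulo 13. *)
Definition cube_diff : rel 'I_13 :=
  fun x y => (x - y) + (y - x) \in [:: 0; 1; 5; 8; 12].

Definition noncube_diff : rel 'I_13 := fun x y => ~~ cube_diff x y.

Lemma noncube_diff_sym : symmetric noncube_diff.
Proof. by move=> x y; rewrite /noncube_diff /cube_diff addnC. Qed.

Lemma noncube_diff_irrefl : irreflexive noncube_diff.
Proof. by move=> x; rewrite /noncube_diff /cube_diff subnn. Qed.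

Definition noncube_graph : sgraph := SGraph noncube_diff_sym noncube_diff_irrefl.

(** This list evaluates to thirteen explicit ordinals; [enum] does not reduce. *)
Definition residues : seq 'I_13 := pmap (insub_eq _) (iota 0 13).

Lemma residuesE : residues = enum 'I_13.
Proof.
by rewrite enumT unlock /= /ord_enum /residues; apply: eq_pmap; apply: insub_eqE.
Qed.

Lemma residues_uniq : uniq residues.
Proof. by rewrite residuesE enum_uniq. Qed.

Lemma residues_full : [set x in residues] = [set: 'I_13].
Proof. by apply/setP => x; rewrite residuesE !inE mem_enum. Qed.

Lemma noncube_clique5 : ~~ has_clique noncube_diff 5 setT.
Proof.
apply/negP; rewrite -residues_full => /search_clique_complete.
by vm_compute.
Qed.

(** The sum of two nonzero cubes is never a nonzero cube modulo 13: three
    residues with pairwise cubic differences would contradict this. *)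
Lemma noncube_independent3 : ~~ has_clique cube_diff 3 setT.
Proof.
apply/negP; rewrite -residues_full => /search_clique_complete.
by vm_compute.
Qed.

Lemma card_independent (V : {set 'I_13}) : ~~ has_clique noncube_diff 2 V -> #|V| <= 2.
Proof.
move=> noE; rewrite leqNgt; apply/negP => V3.
have cV : covered noncube_diff cube_diff V.
  by apply/rcliqueP => x y _ _ _ /=; rewrite orNb.
have /orP [e|i3] := ramsey_2 noncube_diff_sym cV V3; first by rewrite e in noE.
by move/negP: noncube_independent3; apply; apply: has_clique_sub i3; apply: subsetT.
Qed.

(** Ramsey's bound 9 for the coloring of the pairs by cube or non-cube. *)
Lemma clique4_of_card9 (V : {set 'I_13}) : 9 <= #|V| -> has_clique noncube_diff 4 V.
Proof.
move=> V9.
have cube_sym : symmetric cube_diff by move=> x y; rewrite /cube_diff addnC.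
have cV : covered cube_diff noncube_diff V.
  by apply/rcliqueP => x y _ _ _ /=; rewrite orbN.
have /orP [i3|//] := ramsey_3_4 cube_sym noncube_diff_sym cV V9.
by move/negP: noncube_independent3; case; apply: has_clique_sub i3; apply: subsetT.
Qed.

(** Among the 2 ^ 13 partitions the search visits only those not yet decided by
    a prefix of the residues. *)
Lemma noncube_split (V : {set 'I_13}) :
  has_clique noncube_diff 3 V || has_clique noncube_diff 4 (~: V).
Proof.
apply: (search_split_sound (rest := residues) (A := [::]) (B := [::])).
- exact: noncube_diff_sym.
- by rewrite !cats0 residues_uniq.
- by [].
- by [].
- by vm_compute.
Qed.

(** * Joining a complete graph *)

Definition join_adj (m : nat) (H : sgraph) : rel ('I_m + H) :=
  fun x y => match x, y with
             | inl i, inl j => i != j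
             | inr p, inr q => adj p q
             | _, _ => true
             end.

Lemma join_adj_sym (m : nat) (H : sgraph) : symmetric (@join_adj m H).
Proof. by move=> [i|p] [j|q] //=; [rewrite eq_sym | apply: adj_sym]. Qed.

Lemma join_adj_irrefl (m : nat) (H : sgraph) : irreflexive (@join_adj m H).
Proof. by move=> [i|p] /=; [rewrite eqxx | apply: adj_irrefl]. Qed.

Definition join (m : nat) (H : sgraph) : sgraph :=
  SGraph (@join_adj_sym m H) (@join_adj_irrefl m H).

Lemma card_sum_set (A B : finType) (K : {set A + B}) :
  #|K| = #|inl @^-1: K| + #|inr @^-1: K|.
Proof.
rewrite -!sum1_card big_sumType /=; congr (_ + _); apply: eq_bigl => x;
by rewrite inE.
Qed.

Lemma join_clique_card (m : nat) (H : sgraph) (k : nat) (K : {set join m H}) :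
  ~~ has_clique (@adj H) k.+1 setT -> clique K -> #|K| <= m + k.
Proof.
move=> noH /rcliqueP cK; rewrite card_sum_set leq_add //.
  by rewrite -[leqRHS](card_ord m) max_card.
rewrite leqNgt; apply: contra noH => big.
apply: has_clique_sub (subsetT (inr @^-1: K)) _; apply: rclique_has_clique => //.
apply/rcliqueP => p q; rewrite !inE => pK qK pq; exact: (cK (inr p) (inr q)).
Qed.

(** * Colorings without a monochromatic 4-clique *)

Definition avoids4 (G : sgraph) (red blue : rel G) : Prop :=
  [/\ symmetric red, symmetric blue,
      forall x y : G, adj x y -> red x y || blue x y,
      ~~ has_clique red 4 setT & ~~ has_clique blue 4 setT].

Lemma avoids4C (G : sgraph) (red blue : rel G) :
  avoids4 red blue -> avoids4 blue red.
Proof.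
by case=> rs bs cov r4 b4; split=> // x y; rewrite orbC; apply: cov.
Qed.

Lemma clique_covered (G : sgraph) (red blue : rel G) (K : {set G}) :
  avoids4 red blue -> rclique (@adj G) K -> covered red blue K.
Proof.
case=> _ _ cov _ _ /rcliqueP cK; apply/rcliqueP => x y xK yK xy.
exact/cov/cK.
Qed.

Lemma blue_edge_of_clique4 (G : sgraph) (red blue : rel G) (K : {set G}) :
  avoids4 red blue -> rclique (@adj G) K -> 4 <= #|K| ->
  exists x y, [/\ x \in K, y \in K, x != y & blue x y].
Proof.
move=> av cK K4; have [rs bs cov /negP r4 b4] := av.
have /orP [/has_clique2 //|] := ramsey_2 bs (coveredC (clique_covered av cK)) K4.
by move/(has_clique_sub (subsetT _)).
Qed.

(** A 9-clique would contain a blue 4-clique or a red triangle, and [v] extends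
    the triangle. *)
Lemma red_nbr_clique_small (G : sgraph) (red blue : rel G) (v : G) (K : {set G}) :
  avoids4 red blue -> rclique (@adj G) K -> K \subset nbr red setT v -> #|K| <= 8.
Proof.
move=> av cK KN; rewrite leqNgt; apply/negP => K9.
have [rs bs cov r4 b4] := av.
have /orP [r3|] := ramsey_3_4 rs bs (clique_covered av cK) K9.
  case/negP: r4; apply: (has_clique_nbr (v := v)) => //.
  exact: has_clique_sub r3.
by move/(has_clique_sub (subsetT _)); apply/negP.
Qed.

(** Relations on vertices replace colors on edges: a pair of vertices is related
    by [col i] when some edge with these ends has color [i]. *)
Lemma edge_arrows_4_4 (G : sgraph) :
  (forall red blue : rel G, ~ avoids4 red blue) -> edge_arrows G [tuple 4; 4].
Proof.
move=> arrows c.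
pose col (i : 'I_2) : rel G := fun x y =>
  adj x y && [exists e : edge G, (val e == [set x; y]) && (c e == i)].
have col_sym i : symmetric (col i).
  by move=> x y; rewrite /col adj_sym setUC.
have mono i : has_clique (col i) 4 setT ->
    exists K : {set G}, pclique 4 K /\ monochromatic c i K.
  case/has_cliqueP => K [_ cK /rcliqueP colK]; exists K; split.
    rewrite /pclique cK eqxx andbT; apply/rcliqueP => x y xK yK xy.
    by have /andP [] := colK x y xK yK xy.
  move=> e; have /imset2P [x y _] := valP e; rewrite inE => axy defe.
  rewrite defe subUset !sub1set => /andP [xK yK].
  have xy : x != y by apply: contraTneq axy => ->; rewrite adj_irrefl.
  have /andP [_ /existsP [e' /andP [/eqP defe' /eqP <-]]] := colK x y xK yK xy.
  by congr c; apply: val_inj; rewrite /= defe defe'.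
case: (boolP (has_clique (col ord0) 4 setT)) => [/mono [K KP]|no0].
  by exists ord0, K.
case: (boolP (has_clique (col ord_max) 4 setT)) => [/mono [K KP]|no1].
  by exists ord_max, K.
case: (arrows (col ord0) (col ord_max)); split=> // x y axy.
have exy : [set x; y] \in edges G by apply/imset2P; exists x y; rewrite ?inE.
pose e : edge G := exist _ [set x; y] exy.
have in_col i : c e = i -> col i x y.
  by move=> ce; rewrite /col axy; apply/existsP; exists e; rewrite ce !eqxx.
apply/orP.
have : (c e == ord0) || (c e == ord_max) by case: (c e) => [[|[]]].
by case/orP => /eqP /in_col; [left | right].
Qed.

Definition inl_nbr (m : nat) (H : sgraph) (r : rel (join m H)) (i : 'I_m) :
    {set 'I_m} :=
  [set j | (j != i) && r (inl i) (inl j)].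

Definition inr_nbr (m : nat) (H : sgraph) (r : rel (join m H)) (i : 'I_m) :
    {set H} :=
  [set q | r (inl i) (inr q)].

(** The neighbors of [i] inside the complete graph are adjacent to all vertices
    of [H], so they enlarge every clique of [H] in the neighborhood of [i]. *)
Lemma nbr_clique_sum (m : nat) (H : sgraph) (red blue : rel (join m H))
    (i : 'I_m) (k : nat) :
  avoids4 red blue -> has_clique (@adj H) k (inr_nbr red i) ->
  #|inl_nbr red i| + k <= 8.
Proof.
move=> av /has_cliqueP [C [/subsetP CN <- /rcliqueP cC]].
pose K : {set join m H} := [set x | match x with inl j => j \in inl_nbr red i
                                             | inr q => q \in C end].
have -> : #|inl_nbr red i| + #|C| = #|K|.
  by rewrite card_sum_set; congr (_ + _); apply: eq_card => x; rewrite !inE.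
apply: (@red_nbr_clique_small (join m H) red blue (inl i) K av).
  apply/rcliqueP => -[j|p] [l|q]; rewrite !inE //= => pC qC pq; exact: cC.
by apply/subsetP => -[j|q]; rewrite !inE //= => /CN; rewrite inE.
Qed.

Lemma card_inl_nbr (m : nat) (H : sgraph) (red blue : rel (join m H)) (i : 'I_m) :
  avoids4 red blue -> m <= (#|inl_nbr red i| + #|inl_nbr blue i|).+1.
Proof.
case=> _ _ cov _ _; rewrite -[leqLHS](card_ord m) (cardD1 i) inE add1n ltnS.
apply: leq_trans (leq_card_setU _ _); apply: subset_leq_card.
apply/subsetP => j; rewrite !inE andbT => ji; rewrite ji /=; apply: cov => /=.
by rewrite eq_sym.
Qed.

Lemma inr_nbr_covered (m : nat) (H : sgraph) (red blue : rel (join m H)) (i : 'I_m) :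
  avoids4 red blue -> ~: inr_nbr red i \subset inr_nbr blue i.
Proof.
case=> _ _ cov _ _; apply/subsetP => q; rewrite !inE => /negbTE nr.
by have := cov (inl i) (inr q) isT; rewrite nr.
Qed.

Lemma one_color_scarce (red blue : rel (join 12 noncube_graph)) (i : 'I_12) :
  avoids4 red blue -> (#|inr_nbr red i| <= 2) || (#|inr_nbr blue i| <= 2).
Proof.
wlog red6 : red blue / 6 <= #|inl_nbr red i|.
  move=> IH av; have deg := card_inl_nbr i av.
  case: (leqP 6 #|inl_nbr red i|) => [h|h]; first exact: IH.
  by rewrite orbC; apply: IH (avoids4C av); lia.
move=> av; case: (leqP 7 #|inl_nbr red i|) => [red7|red_lt].
  apply/orP; left; apply: card_independent; apply/negP.
  by move/(nbr_clique_sum av); lia.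
have deg := card_inl_nbr i av.
(* Now the red degree is 6 and the blue one at least 5, so 6 + 3 or 5 + 4. *)
have /orP [r3|] := noncube_split (inr_nbr red i).
  by have := nbr_clique_sum av r3; lia.
move/(has_clique_sub (inr_nbr_covered i av)).
by move/(nbr_clique_sum (avoids4C av)); lia.
Qed.

(** Two of four such vertices span a blue edge and share nine blue neighbors in
    the other factor; a blue edge there would complete a blue 4-clique. *)
Lemma red_not_scarce (red blue : rel (join 12 noncube_graph)) (S : {set 'I_12}) :
  avoids4 red blue -> {in S, forall i, #|inr_nbr red i| <= 2} -> #|S| <= 3.
Proof.
move=> av scarce; rewrite leqNgt; apply/negP => S4.
have [rs bs cov r4 /negP b4] := av.
have [i [j [iS jS ij bij]]] : exists i j, [/\ i \in S, j \in S, i != j &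
    blue (inl i) (inl j)].
  have [||x [y [/imsetP [i iS ->] /imsetP [j jS ->] xy bxy]]] :=
      blue_edge_of_clique4 (K := inl @: S : {set join 12 noncube_graph}) av.
  - by apply/rcliqueP => _ _ /imsetP [i iS ->] /imsetP [j jS ->].
  - by rewrite card_imset // => x y [].
  - by exists i, j.
pose P := ~: (inr_nbr red i :|: inr_nbr red j).
have P9 : 9 <= #|P|.
  rewrite /P cardsCs setCK card_ord; apply: (leq_sub2l 13 (n := 4)).
  exact: leq_trans (leq_card_setU _ _) (leq_add (scarce i iS) (scarce j jS)).
have blueP k p : k \in [:: i; j] -> p \in P -> blue (inl k) (inr p).
  move=> kij; rewrite !inE negb_or => /andP [ni nj].
  have := cov (inl k) (inr p) isT.
  by move: kij; rewrite !inE => /pred2P [->|->]; rewrite ?(negbTE ni) ?(negbTE nj).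
have /has_cliqueP [C [/subsetP CP C4 /rcliqueP cC]] := clique4_of_card9 P9.
have [||x [y [/imsetP [p pC ->] /imsetP [q qC ->] xy bpq]]] :=
    blue_edge_of_clique4 (K := inr @: C : {set join 12 noncube_graph}) av.
- apply/rcliqueP => _ _ /imsetP [p pC ->] /imsetP [q qC ->] pq; exact: cC.
- by rewrite card_imset ?C4 // => x y [].
have [pP qP] := (CP p pC, CP q qC).
apply: b4; apply/has_cliqueP.
pose left k : join 12 noncube_graph := inl k.
pose right p' : join 12 noncube_graph := inr p'.
exists (left i |: (left j |: (right p |: [set right q]))); split=> //.
  have ij' : left i != left j by [].
  by rewrite !cardsU1 cards1 !inE (negbTE ij') xy.
have [iB jB] : i \in [:: i; j] /\ j \in [:: i; j] by rewrite !inE !eqxx orbT.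
apply: rclique_setU1 => // [z|].
  by rewrite !in_setU1 in_set1 => /or3P [] /eqP -> _ //; apply: blueP.
apply: rclique_setU1 => // [z|].
  by rewrite in_setU1 in_set1 => /orP [] /eqP -> _ //; apply: blueP.
apply: rclique_setU1 => // [z /set1P -> //|].
by apply/rcliqueP => z z' /set1P -> /set1P ->; rewrite eqxx.
Qed.

Lemma not_avoids4_join (red blue : rel (join 12 noncube_graph)) : ~ avoids4 red blue.
Proof.
move=> av.
pose S (r : rel (join 12 noncube_graph)) := [set i : 'I_12 | #|inr_nbr r i| <= 2].
have redS : #|S red| <= 3 by apply: (red_not_scarce av) => i; rewrite inE.
have blueS : #|S blue| <= 3.
  by apply: (red_not_scarce (avoids4C av)) => i; rewrite inE.
have : #|S red :|: S blue| = 12.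
  rewrite -[RHS](card_ord 12) -cardsT; congr #|pred_of_set _|.
  by apply/setP => i; rewrite !inE; apply: one_color_scarce.
have := leq_trans (leq_card_setU (S red) (S blue)) (leq_add redS blueS).
by move=> le6 eq12; rewrite eq12 in le6.
Qed.

(** Excluded middle is needed to pick the least order, as having a Folkman graph
    of a given order is a proposition without a decision procedure here. *)
Lemma folkman_graph_minimum (r : nat) (a : r.-tuple nat) (q : nat) (G : sgraph) :
  edge_folkman_graph a q G ->
  exists n, is_edge_folkman_number a q n /\ n <= #|G|.
Proof.
move=> FG.
pose P n := exists G : sgraph, edge_folkman_graph a q G /\ #|G| = n.
have exP : exists n, P n by exists #|G|, G.
have [n [[Pn min_n] _]] :=
  dec_inh_nat_subset_has_unique_least_element P (fun n => classic (P n)) exP.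
exists n; split; last by apply/leP/min_n; exists G.
by split=> // H FH; apply/leP/min_n; exists H.
Qed.

Theorem theorem2 :
  exists n : nat, is_edge_folkman_number [tuple 4; 4] 17 n /\ n <= 25.
Proof.
have FG : edge_folkman_graph [tuple 4; 4] 17 (join 12 noncube_graph).
  split; first exact: edge_arrows_4_4 not_avoids4_join.
  rewrite ltnS; apply/bigmax_leqP => K cK.
  exact: (@join_clique_card 12 noncube_graph 4 K noncube_clique5 cK).
have [n [Fn n_le]] := folkman_graph_minimum FG.
exists n; split=> //; apply: leq_trans n_le _.
by rewrite card_sum !card_ord.
Qed.
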